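(* Let $G_2 := \bigoplus_{n=1}^{\infty} \mathbb{Z}/2\mathbb{Z}$. There is a set $S \subseteq G_2$ such that for all $g \in G_2$, the translate $S+g := \{s+g : s \in S\}$ is a set of topological recurrence, while $S$ is not a set of measurable recurrence.
   Context: Let $G$ be a countable abelian group. A measure preserving $G$-system is a triple $(X,\mu,T)$ where $(X,\mu)$ is a probability measure space and $T$ is an action of $G$ on $X$ preserving $\mu$, i.e. $\mu(T^gD)=\mu(D)$ for every measurable $D\subseteq X$ and every $g\in G$. A topological $G$-system is a pair $(X,T)$ where $X$ is a (nonempty) compact metric space and $T$ is an action of $G$ on $X$ by homeomorphisms; it is minimal if for every $x\in X$ the orbit $\{T^gx : g\in G\}$ is dense in $X$. A set $S\subseteq G$ is a set of measurable recurrence if for every measure preserving $G$-system $(X,\mu,T)$ and every measurable $D\subseteq X$ with $\mu(D)>0$, there exists $g\in S$ such that $\mu(D\cap T^gD)>0$. A set $S\subseteq G$ is a set of topological recurrence if for every minimal topological $G$-system $(X,T)$ and every nonempty open $U\subseteq X$, there exists $g\in S$ such that $U\cap T^gU\neq\varnothing$. *)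

(* Defs.v *)
From HB Require Import structures.
From mathcomp Require Import all_boot all_order all_algebra.
From mathcomp Require Import finmap.
From mathcomp Require Import all_classical all_reals all_analysis.
(* The notations of monalg clash with those of analysis, so only its
   structure instances and coercions are imported. *)
From mathcomp Require monalg.
Import(canonicals, coercions) monalg.

Set Implicit Arguments.
Unset Strict Implicit.
Unset Printing Implicit Defensive.

Import Order.TTheory GRing.Theory Num.Theory.

Local Open Scope classical_set_scope.
Local Open Scope ring_scope.

Section Recurrence.
Variables (R : realType) (G : countZmodType).

Definition is_action (X : Type) (T : G -> X -> X) : Prop :=
  (forall x, T 0 x = x) /\ (forall g h x, T (g + h) x = T g (T h x)).

(* The image T g @` D is measurable, being the preimage of D under T (- g). *)
Definition measure_preserving_action (d : measure_display)
    (X : measurableType d) (mu : probability X R) (T : G -> X -> X) : Prop :=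
  [/\ is_action T,
      forall g, measurable_fun [set: X] (T g) &
      forall g (D : set X), measurable D -> mu (T g @` D) = mu D].

(* Each T g is a homeomorphism, its inverse T (- g) being continuous too. *)
Definition continuous_action (X : topologicalType) (T : G -> X -> X) : Prop :=
  is_action T /\ (forall g, continuous (T g)).

Definition minimal_system (X : metricType R) (T : G -> X -> X) : Prop :=
  [/\ [set: X] !=set0,
      compact [set: X],
      continuous_action T &
      forall x, dense [set T g x | g in [set: G]]].

Definition measurable_recurrence (S : set G) : Prop :=
  forall (d : measure_display) (X : measurableType d) (mu : probability X R)
    (T : G -> X -> X), measure_preserving_action mu T ->
  forall D : set X, measurable D -> (0 < mu D)%E ->
  exists2 g, S g & (0 < mu (D `&` T g @` D))%E.

Definition topological_recurrence (S : set G) : Prop :=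
  forall (X : metricType R) (T : G -> X -> X), minimal_system T ->
  forall U : set X, open U -> U !=set0 ->
  exists2 g, S g & U `&` T g @` U !=set0.

End Recurrence.

(* {malg 'Z_2[nat]}: the finitely supported functions nat -> 'Z_2 under
   pointwise addition, i.e. the direct sum of copies of Z/2Z indexed by nat. *)
Definition G2 : Type := monalg.malg nat 'Z_2.

HB.instance Definition _ := GRing.Zmodule.on G2.
HB.instance Definition _ := [Countable of G2 by <:].

(* Main.v *)
(* The Cayley graph of (Z/2)^(2n) with respect to the vectors of weight
   2(n - k) contains the Kneser graph of the (n - k)-subsets of a 2n-set, so its
   chromatic number exceeds 2k (Lovasz).  On the other hand, the majority colouring
   is a proper 2-colouring of it outside the vectors of weight between n - k and
   n + k, which have arbitrarily small density when n is large compared to k.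

   Place such a configuration on consecutive blocks of coordinates of G_2, one for
   each k, and let S be the union over k of g_k + S_k, where S_k lives on the k-th
   block, g_k lives below it, and every element of G_2 equals g_k for infinitely
   many k.  Every translate of S contains infinitely many of the S_k, hence its
   Cayley graph has infinite chromatic number; covering a minimal system by
   finitely many translates of U turns this into topological recurrence.

   For the failure of measurable recurrence, let x -> x + g be the translation
   action on {0,1}^N with the coin-tossing measure, and conjugate it by the
   measure-preserving involutions x -> x + m_k(x) (g_k + e_0), where m_k is the
   majority bit of the k-th block.  For g in G_2 only finitely many of these matter,
   and for s = g_k + t in g_k + S_k the conjugate action sends u to u + t + e_0
   whenever the majority bit of the k-th block is flipped.  The set of all u with
   u_0 = 0 and with no balanced block has positive measure, and is disjoint from
   its image under every s in S.

   For the Kneser graph, a mod 2 count shows that every antipodal choice of signs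
   for the nonempty signed subsets of a d-set alternates along some chain
   A_1 < ... < A_d; applied to the sign of the larger of the maximal colours
   occurring on the two sides of A, this bounds the number of colours below. *)

Require Import Defs.
From mathcomp Require Import all_boot all_order all_algebra zify ring.

Set Implicit Arguments.
Unset Strict Implicit.
Unset Printing Implicit Defensive.

(** * Alternating chains of signed sets and Kneser's conjecture *)

Section Parity.
Variable T : finType.
Implicit Types (J x y : {set T}).

(** Every unordered pair contributes twice; the order of [enum_rank] splits the sum into two halves
    with equal values. *)
Lemma addb_sum_sym J (F : T -> T -> bool) : (forall a b, F a b = F b a) ->
  \big[addb/false]_(a in J) \big[addb/false]_(b in J :\ a) F a b = false.
Proof.
move=> Fsym.
pose lt (a b : T) := enum_rank a < enum_rank b.
have split a : \big[addb/false]_(b in J :\ a) F a b =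
    \big[addb/false]_(b in J | lt a b) F a b (+)
    \big[addb/false]_(b in J | lt b a) F a b.
  rewrite (bigID (lt a)) /=; congr (_ (+) _); apply: eq_bigl => b; rewrite !inE /lt.
    by case: eqVneq => [->|_]; rewrite ?ltnn ?andbF ?andbT.
  case: eqVneq => [->|nab]; rewrite ?ltnn ?andbF //= -leqNgt leq_eqVlt.
  by rewrite (inj_eq val_inj) (inj_eq enum_rank_inj) (negPf nab).
rewrite (eq_bigr _ (fun a _ => split a)) big_split /=.
rewrite [X in _ (+) X](exchange_big_dep (mem J)) /=; last by move=> a b _ /andP[].
have addb_eq (p q : bool) : p = q -> p (+) q = false by move=> ->; exact: addbb.
apply: addb_eq; apply: eq_bigr => a aJ; apply: eq_big => b; last by rewrite Fsym.
by rewrite aJ.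
Qed.

Lemma addb_sum_subsetD1 (j : T) J (F : {set T} -> bool) : j \in J ->
  \big[addb/false]_(x : {set T} | x \subset J) F x =
  \big[addb/false]_(x : {set T} | x \subset J :\ j) (F x (+) F (j |: x)).
Proof.
move=> jJ; rewrite (bigID (fun x : {set T} => j \in x)) big_split /= addbC.
congr (_ (+) _); first by apply: eq_bigl => x; rewrite subsetD1.
rewrite (reindex_onto (fun x : {set T} => j |: x) (fun x => x :\ j)) /=; last first.
  by move=> x /andP[_ jx]; rewrite setD1K.
apply: eq_bigl => x; rewrite setU11 andbT subUset sub1set jJ subsetD1 /=.
congr andb; apply/eqP/idP => [<-|jx]; first by rewrite !inE eqxx.
by rewrite setU1K.
Qed.

Variable s : {set T} -> {set T} -> bool.
Hypothesis s_local : forall J x y, x :&: J = y :&: J -> s J x = s J y.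
Hypothesis s_antipodal : forall J x, J != set0 -> s J (~: x) = ~~ s J x.

(* A signed set is a pair (J, x): its support is J and its positive part is
   x :&: J.  [alt_parity k J x] is the parity of the number of chains of signed subsets
   of sizes 1, ..., k ending in (J, x) along which the sign s alternates,
   starting from the sign [true].  It is meant for k = #|J|. *)
Fixpoint alt_parity k J x : bool :=
  if k is k'.+1 then
    (s J x == odd k) && \big[addb/false]_(a in J) alt_parity k' (J :\ a) x
  else true.

Arguments alt_parity : simpl never.

Lemma alt_parityS k J x :
  alt_parity k.+1 J x =
  (s J x == odd k.+1) && \big[addb/false]_(a in J) alt_parity k (J :\ a) x.
Proof. by []. Qed.

Lemma alt_parity_local k J x y : x :&: J = y :&: J -> alt_parity k J x = alt_parity k J y.
Proof.
elim: k J => [//|k IH] J xy; rewrite !alt_parityS (s_local xy); congr andb.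
apply: eq_bigr => a _; apply: IH.
by rewrite setDE !setIA xy.
Qed.

Let pre_parity k J x := \big[addb/false]_(a in J) alt_parity k (J :\ a) x.

(* By induction, the two sides differ by the sum of [alt_parity k (J :\ a :\ b) x]
   over ordered pairs of distinct a, b, where every term occurs twice. *)
Lemma pre_parityC k J x : #|J| = k.+1 -> pre_parity k J (~: x) = pre_parity k J x.
Proof.
rewrite /pre_parity; elim: k J => [//|k IH] J Jk.
have addb_eq (p q : bool) : p (+) q = false -> p = q by case: p; case: q.
apply: addb_eq; rewrite -big_split /=.
rewrite (eq_bigr (fun a => \big[addb/false]_(b in J :\ a) alt_parity k (J :\ a :\ b) x)).
  by rewrite addb_sum_sym// => a b; rewrite [J :\ a :\ b]setDDl setUC -setDDl.
move=> a aJ; have cJa : #|J :\ a| = k.+1 by move: Jk; rewrite (cardsD1 a) aJ => -[].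
rewrite !alt_parityS s_antipodal -?card_gt0 ?cJa// (IH _ cJa) /=.
by case: s; case: odd; case: (\big[_/_]_(_ in _) _).
Qed.

(** Antipodality lets exactly one of [x] and [~: x] pass the sign test, and by [pre_parityC] the
    remaining factor is the same for both. *)
Lemma alt_parityC k J x : #|J| = k.+1 ->
  alt_parity k.+1 J x (+) alt_parity k.+1 J (~: x) = pre_parity k J x.
Proof.
move=> Jk; rewrite !alt_parityS -!/(pre_parity _ _ _) pre_parityC//.
rewrite s_antipodal -?card_gt0 ?Jk//.
by case: s; case: odd; case: pre_parity.
Qed.

(* Fix j in J and pair each x with J :\: x: the sum becomes that of the
   [pre_parity k J x] over x not containing j, where the terms with a != j cancel
   in pairs x, a |: x and those with a = j form the sum for J :\ j. *)
Lemma alt_parity_sum k J : #|J| = k ->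
  \big[addb/false]_(x : {set T} | x \subset J) alt_parity k J x.
Proof.
elim: k J => [|k IH] J Jk.
  rewrite (eq_bigl (pred1 set0)) ?big_pred1_eq// => x.
  by rewrite (cards0_eq Jk) subset0.
have /card_gt0P[j jJ] : 0 < #|J| by rewrite Jk.
have cJj : #|J :\ j| = k by move: Jk; rewrite (cardsD1 j) jJ => -[].
rewrite (addb_sum_subsetD1 _ jJ) big_split /=.
(* Complement in [J :\ j], extended by the identity to an injection on all sets, as reindexing
   requires. *)
pose compl x := if x \subset J :\ j then (J :\ j) :\: x else x.
rewrite [X in _ (+) X](reindex_inj (h := compl)) /compl /=; last first.
  move=> x y; case: ifP => xJ; case: ifP => yJ //.
  - move/(congr1 (setD (J :\ j))); rewrite [LHS]setDDr [RHS]setDDr setDv !set0U.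
    by move/setIidPr: xJ => ->; move/setIidPr: yJ => ->.
  - by move=> E; rewrite -E subsetDl in yJ.
  - by move=> E; rewrite E subsetDl in xJ.
rewrite [X in _ (+) X](eq_bigl (fun x : {set T} => x \subset J :\ j)); last first.
  by move=> x; case: ifP => //; rewrite subsetDl.
rewrite -big_split /= (eq_bigr (fun x => pre_parity k J x)); last first.
  move=> x xJ; rewrite -alt_parityC// xJ; congr (_ (+) _); apply: alt_parity_local.
  apply/setP => i; rewrite !inE; case: eqVneq => [->|_] /=; last first.
    by case: (i \in J); rewrite ?andbF ?andbT.
  by rewrite jJ andbT; apply/esym/negP => /(subsetP xJ); rewrite !inE eqxx.
rewrite exchange_big (bigD1 j)//=.
rewrite [X in _ (+) X]big1 => [|a /andP[aJ aj]].
  by rewrite addbF; exact: IH.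
rewrite (@addb_sum_subsetD1 a) ?inE ?aj//.
rewrite big1// => x _; rewrite (@alt_parity_local _ _ (a |: x) x) ?addbb//.
by apply/setP => i; rewrite !inE; case: eqVneq; rewrite ?andbF.
Qed.

Lemma alt_parity_exists : exists x, alt_parity #|T| setT x.
Proof.
apply/existsP; apply: contraT; rewrite negb_exists => /forallP h.
have := alt_parity_sum (cardsT T); rewrite big1// => x _; exact/negbTE/h.
Qed.

End Parity.

(** * Kneser graphs: labelling signed sets by colours *)

Section Kneser.
Variables (T : finType) (c r : nat) (chi : {set T} -> 'I_c).
Hypothesis r_gt0 : 0 < r.
Hypothesis chi_proper : forall B B' : {set T},
  #|B| = r -> #|B'| = r -> [disjoint B & B'] -> chi B <> chi B'.
Implicit Types (J x y : {set T}).

(* P J x and P J (~: x) are the sets of colours occurring on the two sides of the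
   signed set (J, x).  [label] is monotone in the signed set and takes different
   values at two comparable ones of different signs, so alternating chains of
   length k end at label at least k. *)
Let P J x := [set chi B | B : {set T} & (B \subset x :&: J) && (#|B| == r)].
Let C J x := P J x :|: P J (~: x).
Let top J x : nat := \max_(i in C J x) i.
(** By [no_colour_card] the offset [r.*2.-1] puts the labels of coloured signed sets above those of
    uncoloured ones. *)
Let label J x := if C J x == set0 then #|J| else (r.*2.-1 + top J x)%N.
(** Without colours the label is the size, so any antipodal sign will do: that of an element picked
    from [J] alone. *)
Let sgn J x := if C J x == set0 then
    (if [pick a in J] is Some a then a \in x else true)
  else [exists i in P J x, i == top J x :> nat].

Let setC_local J x y : x :&: J = y :&: J -> ~: x :&: J = ~: y :&: J.
Proof.
move=> xy; apply/setP => i; move/setP/(_ i): xy; rewrite !inE.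
by case: (i \in J); rewrite ?andbF // !andbT => ->.
Qed.

Let C_local J x y : x :&: J = y :&: J -> C J x = C J y.
Proof. by move=> xy; rewrite /C /P xy (setC_local xy). Qed.

Let CC J x : C J (~: x) = C J x.
Proof. by rewrite /C setCK setUC. Qed.

Let sgn_local J x y : x :&: J = y :&: J -> sgn J x = sgn J y.
Proof.
move=> xy; rewrite /sgn /top (C_local xy); case: ifP => _.
  case: pickP => // a aJ; move/setP/(_ a): xy.
  by rewrite !inE [a \in J]aJ !andbT.
by rewrite /P xy.
Qed.

Let P_disj J x i : i \in P J x -> i \in P J (~: x) -> False.
Proof.
case/imsetP => B; rewrite inE => /andP[sB /eqP cB] ->.
case/imsetP => B'; rewrite inE => /andP[sB' /eqP cB']; apply: chi_proper => //.
move: sB sB'; rewrite !subsetI => /andP[sB _] /andP[sB' _].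
by rewrite disjoints_subset (subset_trans sB)// -setCS setCK.
Qed.

Let P_mono J J' x : J \subset J' -> P J x \subset P J' x.
Proof.
move=> sJ; apply: imsetS; apply/subsetP => B; rewrite !inE => /andP[sB ->].
by rewrite (subset_trans sB)// setIS.
Qed.

Let topP J x : C J x != set0 -> exists2 i : 'I_c, i \in C J x & i = top J x :> nat.
Proof.
case/set0Pn => i iC; have : 0 < #|C J x| by apply/card_gt0P; exists i.
by move/(eq_bigmax_cond (fun i : 'I_c => i : nat)) => [k kC E]; exists k.
Qed.

Let sgn_antipodal J x : J != set0 -> sgn J (~: x) = ~~ sgn J x.
Proof.
move=> J0; rewrite /sgn /top CC; case: ifP => [_|/negbT C0].
  case: pickP => [a _|no]; first by rewrite inE.
  by case/set0Pn: J0 => a; rewrite no.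
have [i iC iE] := topP C0.
have E y : C J y = C J x -> [exists i0 in P J y, i0 == top J x :> nat] = (i \in P J y).
  move=> _; apply/existsP/idP => [[k /andP[kP /eqP kE]]|iP].
    by rewrite (_ : i = k)//; apply: val_inj; rewrite /= kE.
  by exists i; rewrite iP iE eqxx.
rewrite -/(top J x) !E ?CC//; move: iC; rewrite inE.
have := @P_disj J x i; case: (i \in P J x); case: (i \in P J (~: x)) => //.
by move=> H; case: H.
Qed.

(** Each side has at most [r.-1] elements, or else an [r]-subset of it would show its colour. *)
Let no_colour_card J x : C J x = set0 -> #|J| <= r.*2.-2.
Proof.
move=> C0.
have small y : P J y = set0 -> #|y :&: J| < r.
  move=> Cy; rewrite ltnNge; apply/negP => /card_geqP[l [ul sl lJ]].
  have : chi [set i in l] \in P J y.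
    apply/imsetP; exists [set i in l] => //.
    rewrite inE cardsE (card_uniqP ul) sl eqxx andbT.
    by apply/subsetP => i; rewrite inE => /lJ.
  by rewrite Cy inE.
move/eqP: C0; rewrite setU_eq0 => /andP[/eqP/small lt1 /eqP/small lt2].
rewrite -(cardsID x J) setIC; move: lt2; rewrite setIC -setDE; lia.
Qed.

(** The label grows strictly along an alternating chain: if the top colour stayed the same, so would
    its side and hence the sign. *)
Let alt_parity_label k J x : #|J| = k -> alt_parity sgn k J x -> k <= label J x.
Proof.
elim: k J => // k IH J Jk; rewrite alt_parityS => /andP[/eqP sJ].
rewrite /label; case: ifPn => [_|C0 nz]; first by rewrite Jk.
have [a aJ aalt] : exists2 a, a \in J & alt_parity sgn k (J :\ a) x.
  apply/exists_inP; apply: contraTT nz => /exists_inPn no.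
  by rewrite big1// => a /no /negbTE.
have cJa : #|J :\ a| = k by move: Jk; rewrite (cardsD1 a) aJ => -[].
have sub : J :\ a \subset J by rewrite subsetDl.
have := IH _ cJa aalt; rewrite /label; case: ifPn => [/eqP Ca0 _|Ca0 kle].
  by have := no_colour_card Ca0; rewrite cJa; lia.
have mono : C (J :\ a) x \subset C J x by rewrite setUSS// P_mono.
have [i iC iE] := topP Ca0.
have le : top (J :\ a) x <= top J x.
  by rewrite -iE /top; apply: (@bigmax_sup _ i) => //; exact: (subsetP mono).
suff: top (J :\ a) x != top J x by lia.
apply/eqP => topE.
have sJa : sgn (J :\ a) x = odd k.
  (* For [k = 0] the parity says nothing about the sign, but the empty signed set shows no colour
     since [0 < r]. *)
  case: k {IH kle} Jk cJa aalt sJ nz => [|k] Jk cJa; last first.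
    by rewrite alt_parityS => /andP[/eqP].
  case/negP: Ca0; rewrite (cards0_eq cJa) -subset0; apply/subsetP => j.
  rewrite !inE => /orP[] /imsetP[B]; rewrite inE setI0 subset0 => /andP[/eqP->];
    by rewrite cards0; lia.
have : sgn (J :\ a) x = sgn J x; last by rewrite sJa sJ /=; case: odd.
rewrite /sgn (negPf C0) (negPf Ca0) topE.
apply/exists_inP/exists_inP => -[l lP /eqP lE].
  by exists l; rewrite ?lE//; exact: subsetP (P_mono _ sub) _ lP.
have li : l = i by apply: val_inj; rewrite /= lE iE topE.
rewrite -{}li in iC iE *; exists l; last by rewrite lE.
move: iC; rewrite inE => /orP[//|lP'].
by case: (P_disj lP); exact: subsetP (P_mono _ sub) _ lP'.
Qed.

(** A full alternating chain ends at label at least [#|T|], whereas colours are below [c]. *)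
Lemma kneser_bound : #|T| < c + r.*2.-1.
Proof.
have [x /(alt_parity_label (cardsT T))] := alt_parity_exists sgn_local sgn_antipodal.
rewrite /label cardsT; case: ifPn => [/eqP C0 _|C0 le]; last first.
  have [i _ iE] := topP C0; have := ltn_ord i; lia.
by have := no_colour_card C0; have := ltn_ord (chi set0); rewrite cardsT; lia.
Qed.

End Kneser.

Lemma kneser (T : finType) (c r : nat) (chi : {set T} -> 'I_c) :
  0 < r -> c + r.*2 <= #|T|.+1 ->
  exists B B' : {set T},
    [/\ #|B| = r, #|B'| = r, [disjoint B & B'] & chi B = chi B'].
Proof.
move=> r0 le.
have [/existsP[B /existsP[B' /and4P[/eqP ? /eqP ? ? /eqP ?]]]|no] := boolP
  [exists B : {set T}, exists B' : {set T},
     [&& #|B| == r, #|B'| == r, [disjoint B & B'] & chi B == chi B']].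
  by exists B, B'.
suff: #|T| < c + r.*2.-1 by lia.
apply: (kneser_bound (chi := chi)) => // B B' cB cB' dBB' eBB'; case/negP: no.
by apply/existsP; exists B; apply/existsP; exists B'; rewrite cB cB' dBB' eBB' !eqxx.
Qed.

(** * The central binomial coefficient *)

Lemma bin_central_le n i : 'C(n.*2, i) <= 'C(n.*2, n).
Proof.
have up j d : j + d = n -> 'C(n.*2, j) <= 'C(n.*2, n).
  elim: d j => [|d IH] j; first by rewrite addn0 => ->.
  move=> jdn; apply: leq_trans (IH j.+1 _); last by rewrite addSnnS.
  have := mul_bin_left n.*2 j; rewrite -(leq_pmul2l (ltn0Sn j)) => ->.
  by rewrite leq_mul2r; apply/orP; right; lia.
have [le|lt] := leqP i n; first by apply: (up i (n - i)); lia.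
have [le2|lt2] := leqP i n.*2; last by rewrite bin_small.
by rewrite -bin_sub//; apply: (up _ (i - n)); lia.
Qed.

(** The induction step reduces to [(2n + 1)(2n + 3) <= 4(n + 1)^2]. *)
Lemma bin_central_sqr n : 'C(n.*2, n) ^ 2 * n.*2.+1 <= 16 ^ n.
Proof.
elim: n => [//|n IH].
have E : n.+1 * 'C(n.+1.*2, n.+1) = 2 * n.*2.+1 * 'C(n.*2, n).
  rewrite -mul_bin_diag -mul2n -!mulnA (mul_bin_diag n.*2.+1 n); congr (2 * (_ * _)).
  by rewrite mul2n doubleS /= -bin_sub; [congr binomial|]; lia.
rewrite -(leq_pmul2l (m := n.+1 ^ 2)) ?expn_gt0// mulnA -expnMn E !expnMn (expnS 16).
set y := 'C(_, _) ^ 2 in IH *.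
have le : n.*2.+1 * n.+1.*2.+1 <= 4 * n.+1 ^ 2.
  by rewrite -mulnn doubleS -muln2; nia.
have -> : 2 ^ 2 * n.*2.+1 ^ 2 * y * n.+1.*2.+1 =
    4 * (y * n.*2.+1) * (n.*2.+1 * n.+1.*2.+1) by rewrite -(mulnn n.*2.+1); ring.
apply: (leq_trans (leq_mul (leq_mul (leqnn 4) IH) le)).
apply: eq_leq; set z := 16 ^ n; rewrite mulnACA -[4 * 4]/16; ring.
Qed.

Lemma central_window_small k c : exists2 n, k < n &
  #|[set w : {set 'I_n.*2} | n - k <= #|w| <= n + k]| * c <= 2 ^ n.*2.
Proof.
(* The window has [k.*2.+1] levels, each at most the central coefficient; the square makes [n.*2.+1]
   large enough for [bin_central_sqr]. *)
pose n := (k.+1 + (k.*2.+1 * c) ^ 2)%N; exists n; first by rewrite /n; lia.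
apply: (@leq_trans (k.*2.+1 * 'C(n.*2, n) * c)).
  rewrite leq_mul2r; apply/orP; right.
  rewrite -sum1_card (partition_big (fun w : {set 'I_n.*2} =>
    inord (#|w| - (n - k)) : 'I_k.*2.+1) predT)//=.
  rewrite -[leqRHS](_ : \sum_(j < k.*2.+1) 'C(n.*2, n) = _); last first.
    by rewrite sum_nat_const card_ord.
  apply: leq_sum => j _.
  apply: leq_trans (bin_central_le n (n - k + j)).
  have := card_draws 'I_n.*2 (n - k + j); rewrite card_ord => <-.
  rewrite sum1_card; apply/subset_leq_card/subsetP => w.
  rewrite unfold_in /= !inE => /andP[/andP[lo hi] /eqP <-].
  by rewrite inordK; lia.
have -> : (2 ^ n.*2 = 4 ^ n)%N by rewrite -mul2n expnM.
have E16 : ((4 ^ n) ^ 2 = 16 ^ n)%N by rewrite -expnM mulnC expnM.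
rewrite mulnAC mulnC -leq_sqr expnMn E16 (leq_trans _ (bin_central_sqr n))//.
by rewrite leq_mul2l; apply/orP; right; rewrite [in leqRHS]/n; lia.
Qed.

From HB Require Import structures.
From mathcomp Require Import finmap.
From mathcomp Require Import all_classical all_reals all_analysis.
From mathcomp Require Import measurable_realfun lra.
From mathcomp Require monalg.
Import(canonicals, coercions) monalg.

Import Order.TTheory GRing.Theory Num.Theory.

Local Open Scope classical_set_scope.
Local Open Scope ring_scope.

(** * The coin-tossing measure *)

Definition coins : set (set (nat -> bool)) :=
  [set [set u : nat -> bool | u n] | n in setT].
Local Notation bits := (g_sigma_algebraType coins).

Section digits.
Variable R : realType.
Implicit Types (x : R) (n m : nat).

Definition dyadic n x : int := Num.floor (2 ^+ n * x).
Definition digit x n : bool := odd `|dyadic n.+1 x|%N.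
(** Flips one binary digit; on each of the two sets where that digit is constant it is a
    translation. *)
Definition flipr n x : R := if digit x n then x - 2 ^- n.+1 else x + 2 ^- n.+1.

Lemma dyadicS n x :
  dyadic n.+1 x = 2 * dyadic n x + (if digit x n then 1 else 0).
Proof.
have /andP[lo hi] := floor_itv (2 ^+ n * x).
have /andP[lo' hi'] := floor_itv (2 ^+ n.+1 * x).
rewrite /digit -/(dyadic _ _) in lo hi lo' hi' *.
have h1 : 2 * dyadic n x < dyadic n.+1 x + 1.
  by rewrite -(ltr_int R) (le_lt_trans _ hi')// intrM exprS -mulrA ler_wpM2l.
have h2 : dyadic n.+1 x < 2 * (dyadic n x + 1).
  by rewrite -(ltr_int R) (le_lt_trans lo')// intrM exprS -mulrA ltr_pM2l.
case: ifP; lia.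
Qed.

Lemma dyadic_flipr n x :
  dyadic n.+1 (flipr n x) = dyadic n.+1 x + (if digit x n then -1 else 1).
Proof.
rewrite /dyadic /flipr; case: ifP => _; rewrite mulrDr ?mulrN divff ?expf_neq0//.
  by rewrite floorDrz ?rpredN ?rpred1// floorN ?rpred1// floor1.
by rewrite floorDrz ?rpred1// floor1.
Qed.

Lemma digit_fliprr n x : digit (flipr n x) n = ~~ digit x n.
Proof. by rewrite {1}/digit dyadic_flipr; case: ifP; rewrite /digit; lia. Qed.

Lemma dyadic_flipr_le n m x : (m <= n)%N -> dyadic m (flipr n x) = dyadic m x.
Proof.
(* Level [k.+1] determines level [k], so the equality descends from level [n]. *)
have half k y z : dyadic k.+1 y = dyadic k.+1 z -> dyadic k y = dyadic k z.
  by rewrite !dyadicS; case: ifP; case: ifP; lia.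
move=> mn; have -> : m = (n - (n - m))%N by lia.
elim: (n - m)%N (leq_subr m n) => [_|d IH dn].
  have := dyadicS n (flipr n x); have := dyadicS n x; have := dyadic_flipr n x.
  by rewrite digit_fliprr subn0; case: (digit x n) => /=; lia.
by apply: half; rewrite (_ : (n - d.+1).+1 = (n - d)%N); [exact/IH/ltnW|lia].
Qed.

Lemma digit_flipr_gt n m x : (n < m)%N -> digit (flipr n x) m = digit x m.
Proof.
(* At scale [m.+1] the flip moves by an even integer, which preserves the parity of the floor. *)
move=> nm; have E : 2 ^+ m.+1 * 2 ^- n.+1 = (2 * 2 ^+ (m - n).-1)%:~R :> R.
  rewrite intrM rmorphXn /= -exprS prednK ?subn_gt0// -(subnK (ltnW nm)) -addnS.
  by rewrite exprD mulfK ?expf_neq0// addnK.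
rewrite /digit /dyadic /flipr; case: ifP => _; rewrite mulrDr ?mulrN E -?rmorphN /=.
  rewrite floorDrz ?intr_int// intrKfloor.
  by move: (Num.floor _) (2 ^+ _ : int) => z a; lia.
rewrite floorDrz ?intr_int// intrKfloor.
by move: (Num.floor _) (2 ^+ _ : int) => z a; lia.
Qed.

Lemma digit_flipr n m x : digit (flipr n x) m = digit x m (+) (m == n).
Proof.
case: (ltngtP m n) => [mn|nm|->]; last by rewrite digit_fliprr addbT.
- by rewrite addbF /digit dyadic_flipr_le.
- by rewrite addbF digit_flipr_gt.
Qed.

Lemma fliprK n : involutive (flipr n).
Proof.
move=> x; rewrite {1}/flipr digit_fliprr /flipr; case: (digit x n) => /=.
  by rewrite subrK.
by rewrite addrK.
Qed.

Lemma in_unit_flipr n x : (flipr n x \in `[0, 1[) = (x \in `[0, 1[).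
Proof.
have E y : (y \in `[0, 1[) = (dyadic 0 y == 0).
  by rewrite /dyadic expr0 mul1r floor_eq in_itv.
by rewrite !E dyadic_flipr_le.
Qed.

Lemma measurable_digit n : measurable [set x | digit x n].
Proof.
have -> : [set x | digit x n] =
    \bigcup_z ([set x | dyadic n.+1 x = z] `&` [set _ | odd `|z|%N]).
  by apply/seteqP; split=> [x dx|x [z _ [/= <-]]//]; exists (dyadic n.+1 x).
apply: countable_bigcupT_measurable; first exact: countableP.
move=> z; apply: measurableI; last first.
  by case: (odd _); [rewrite (_ : mkset _ = setT)|rewrite (_ : mkset _ = set0)] => //;
     apply/seteqP; split.
have -> : [set x | dyadic n.+1 x = z] =
    `[z%:~R / 2 ^+ n.+1, (z + 1)%:~R / 2 ^+ n.+1[%classic.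
  apply/seteqP; split=> x /=;
    rewrite /dyadic in_itv /= ler_pdivrMr ?ltr_pdivlMr ?exprn_gt0//;
    by rewrite ![x * _]mulrC -floor_eq => /eqP.
exact: measurable_itv.
Qed.

Lemma lebesgue_measureD (c : R) (A : set R) : measurable A ->
  lebesgue_measure ((fun x => x + c) @^-1` A) = lebesgue_measure A :> \bar R.
Proof.
move=> mA.
pose f (x : measurableTypeR R) : measurableTypeR R := x + c.
have mf : measurable_fun setT f.
  by apply: nondecreasing_measurable => // x y xy; rewrite lerD2r.
rewrite -[LHS]/(pushforward lebesgue_measure f A).
apply/esym/lebesgue_measure_unique => //= _ [[a b]] _ <-.
rewrite /pushforward (_ : _ @^-1` _ = `]a - c, b - c]%classic); last first.
  by apply/seteqP; split=> x /=; rewrite !in_itv /= ltrBlDr lerBrDr.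
by rewrite !lebesgue_measure_itv/= !lte_fin ltrD2r -!EFinB opprB addrA subrK.
Qed.

Lemma measurable_coin n : measurable ([set u | u n] : set bits).
Proof. by apply: sub_sigma_algebra; exists n. Qed.

Lemma measurable_bits d (T : measurableType d) (f : T -> bits) :
  (forall n, measurable [set t | f t n]) -> measurable_fun setT f.
Proof.
move=> mf; apply: (@measurability _ _ T bits setT f coins) => //.
by move=> _ [_ [n _ <-] <-]; rewrite setTI; exact: mf.
Qed.

Lemma measurable_digits :
  measurable_fun setT (digit : measurableTypeR R -> bits).
Proof. by apply: measurable_bits => n; exact: measurable_digit. Qed.

Lemma measurable_unit : measurable (`[0, 1[%classic : set (measurableTypeR R)).
Proof. exact: measurable_itv. Qed.

(** Fair coin tosses are the binary digits of a uniform point of [[0, 1[]. *)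
Definition coin_measure : set bits -> \bar R :=
  pushforward (mrestr lebesgue_measure measurable_unit)
    (digit : measurableTypeR R -> bits).

HB.instance Definition _ := Measure.copy coin_measure
  (measure_function_pushforward__canonical__measure_function_Measure
     (mrestr lebesgue_measure measurable_unit) measurable_digits).

Lemma coin_measureE A : coin_measure A = lebesgue_measure (digit @^-1` A `&` `[0, 1[).
Proof. by []. Qed.

Lemma coin_measure_setT : coin_measure setT = 1%E.
Proof.
rewrite coin_measureE preimage_setT setTI lebesgue_measure_itv /= lte_fin ltr01.
by rewrite oppr0 adde0.
Qed.

HB.instance Definition _ :=
  Measure_isProbability.Build _ _ _ coin_measure coin_measure_setT.

Definition addbits (v u : nat -> bool) : bits := fun n => v n (+) u n.
Definition unit_bits (n : nat) : nat -> bool := fun m => m == n.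

Lemma measurable_addbits v : measurable_fun setT (addbits v : bits -> bits).
Proof.
apply: measurable_bits => n; rewrite /addbits; case: (v n); last exact: measurable_coin.
have := measurableC (measurable_coin n); congr measurable.
by apply/seteqP; split=> u /= /negP.
Qed.

Lemma digit_flipr_addbits n x : digit (flipr n x) = addbits (unit_bits n) (digit x).
Proof. by apply/funext => m; rewrite digit_flipr addbC. Qed.

(** Split by the [n]-th digit and use translation invariance of Lebesgue measure on both pieces. *)
Lemma coin_measure_unit_bits n (A : set bits) : measurable A ->
  coin_measure (addbits (unit_bits n) @^-1` A) = coin_measure A.
Proof.
move=> mA; rewrite !coin_measureE.
have mdA : measurable (digit @^-1` A).
  by have := measurable_digits measurableT mA; rewrite setTI.
pose I := `[0, 1[%classic : set R; pose d := 2 ^- n.+1 : R.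
have mI : measurable I by exact: measurable_itv.
have mD := measurable_digit n.
pose B := digit @^-1` A `&` I; have mB : measurable B by exact: measurableI.
pose B1 := B `&` [set x | digit x n]; pose B0 := B `&` ~` [set x | digit x n].
have mB1 : measurable B1 by exact: measurableI.
have mB0 : measurable B0 by apply: measurableI => //; exact: measurableC.
have dB : B1 `&` B0 = set0 by rewrite setIACA setICr setI0.
have -> : digit @^-1` (addbits (unit_bits n) @^-1` A) `&` I =
    (fun x => x + d) @^-1` B1 `|` (fun x => x - d) @^-1` B0.
  apply/seteqP; split=> x.
    case=> /= Ax Ix; case dx : (digit x n); [right|left].
      have fx : flipr n x = x - d by rewrite /flipr dx.
      rewrite /B0 /= /B /I /= -fx in_unit_flipr digit_fliprr dx digit_flipr_addbits.
      by split.
    have fx : flipr n x = x + d by rewrite /flipr dx.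
    by rewrite /B1 /= /B /I /= -fx in_unit_flipr digit_fliprr dx digit_flipr_addbits.
  case=> -[[Ay Iy] dy]; move: Ay Iy dy; rewrite /I /=.
    set y := x + d => Ay Iy dy.
    have <- : flipr n y = x by rewrite /flipr dy /y addrK.
    by rewrite in_unit_flipr -digit_flipr_addbits fliprK.
  set y := x - d => Ay Iy /negP/negbTE dy.
  have <- : flipr n y = x by rewrite /flipr dy /y subrK.
  by rewrite in_unit_flipr -digit_flipr_addbits fliprK.
have mT c C : measurable C -> measurable ((fun x : R => x + c) @^-1` C).
  move=> mC; rewrite -[X in measurable X]setTI.
  by apply: (nondecreasing_measurable _ _ _ mC) => // x y xy; rewrite lerD2r.
rewrite measureU; [|exact: mT|exact: mT|].
  transitivity (lebesgue_measure B1 + lebesgue_measure B0 : \bar R)%E.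
    by congr (_ + _)%E; exact: lebesgue_measureD.
  by rewrite -measureU// -setIUr setUv setIT.
apply/seteqP; split=> // x [].
rewrite /B1 /B0 /= => -[[_ _] d1] [[_ _] /negP d0].
have f1 : flipr n (x + d) = x by rewrite /flipr d1 addrK.
have f0 : flipr n (x - d) = x by rewrite /flipr (negbTE d0) subrK.
have := digit_fliprr n (x + d); have := digit_fliprr n (x - d).
by rewrite f1 f0 d1 d0 => ->.
Qed.

Lemma coin_measure_addbits v N (A : set bits) : (forall n, (N <= n)%N -> v n = false) ->
  measurable A -> coin_measure (addbits v @^-1` A) = coin_measure A.
Proof.
elim: N v => [|N IH] v vN mA.
  rewrite (_ : addbits v @^-1` A = A)//; apply/seteqP; split=> u /=;
  by rewrite (_ : addbits v u = u)//; apply/funext => n; rewrite /addbits vN.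
case vNb : (v N); last first.
  by apply: IH => // n; rewrite leq_eqVlt => /predU1P[<-//|/vN].
pose w := addbits (unit_bits N) v.
have wN n : (N <= n)%N -> w n = false.
  rewrite /w /addbits /unit_bits leq_eqVlt => /predU1P[<-|nN].
    by rewrite eqxx vNb.
  by rewrite vN// gtn_eqF.
have mw : measurable (addbits w @^-1` A : set bits).
  by have := measurable_addbits w measurableT mA; rewrite setTI.
transitivity (coin_measure (addbits w @^-1` A)); last exact: IH.
rewrite -(coin_measure_unit_bits N mw); congr coin_measure.
apply/funext => u /=; congr A; apply/funext => n.
by rewrite /w /addbits addbACA addbb.
Qed.

End digits.

(** * Blocks of coordinates and the uniform law of their patterns *)

Definition pattern (s l : nat) (u : bits) : {set 'I_l} :=
  [set i : 'I_l | u (s + i)%N]%SET.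
Definition in_block (s l n : nat) := (s <= n < s + l)%N.

Section Pattern.
Variables (s l : nat).
Implicit Types (u v : bits) (w : {set 'I_l}).

Lemma eq_pattern u v : (forall n, in_block s l n -> u n = v n) ->
  pattern s l u = pattern s l v.
Proof.
move=> uv; apply/setP => i; rewrite !inE uv// /in_block leq_addr ltn_add2l /=.
exact: ltn_ord.
Qed.

Lemma pattern_addbits_id v u : (forall n, in_block s l n -> v n = false) ->
  pattern s l (addbits v u) = pattern s l u.
Proof. by move=> v0; apply: eq_pattern => n nb; rewrite /addbits v0. Qed.

Lemma measurable_pattern_eq w : measurable [set u | pattern s l u = w].
Proof.
rewrite [X in measurable X](_ : _ =
  \bigcap_(i in [set: 'I_l]) [set u : bits | u (s + i)%N = (i \in w)]); last first.
  apply/seteqP; split=> u /= h; first by move=> i _ /=; rewrite -h inE.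
  by apply/setP => i; rewrite inE; exact: h.
apply: fin_bigcap_measurable => // i _; case: (i \in w); first exact: measurable_coin.
have := measurableC (measurable_coin (s + i)); congr measurable.
by apply/seteqP; split=> u /=; [move/negP/negbTE|move=> ->].
Qed.

Lemma measurable_pattern (P : pred {set 'I_l}) : measurable [set u | P (pattern s l u)].
Proof.
rewrite [X in measurable X](_ : _ =
  \bigcup_(w in [set w | P w]) [set u | pattern s l u = w]); last first.
  by apply/seteqP; split=> u /= h; [exists (pattern s l u)|case: h => w Pw ->].
by apply: fin_bigcup_measurable => // w _; exact: measurable_pattern_eq.
Qed.

Variable R : realType.
Local Notation mu := (@coin_measure R).

Lemma coin_measure_pattern_eq w :
  mu [set u | pattern s l u = w] = mu [set u | pattern s l u = finset.set0].
Proof.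
(* [w] placed on the block and zero elsewhere; adding it exchanges the pattern [w] with the empty
   one. *)
pose v n := (s <= n)%N && (if insub (n - s)%N is Some i then i \in w else false).
have vE (i : 'I_l) : v (s + i)%N = (i \in w).
  by rewrite /v leq_addr addKn; case: insubP => [j _ /val_inj -> //|]; rewrite ltn_ord.
rewrite -(@coin_measure_addbits R v (s + l)).
- congr (mu _); apply/seteqP; split=> u /= /setP h; apply/setP => i;
    by move: (h i); rewrite !inE /addbits vE; case: (i \in w); case: (u _).
- move=> n ln; rewrite /v; case: insubP => [i|]; last by rewrite andbF.
  by move=> + _; lia.
- exact: measurable_pattern_eq.
Qed.

(** All patterns have the same probability [p], which the total mass 1 determines. *)
Lemma coin_measure_pattern (W : {set {set 'I_l}}) :
  mu [set u | pattern s l u \in W] = (#|W|%:R / 2 ^+ l)%:E.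
Proof.
pose p := fine (mu [set u | pattern s l u = finset.set0]).
have pE w : mu [set u | pattern s l u = w] = p%:E.
  rewrite coin_measure_pattern_eq fineK// fin_num_measure//.
  exact: measurable_pattern_eq.
have E (V : {set {set 'I_l}}) : mu [set u | pattern s l u \in V] = (#|V|%:R * p)%:E.
  rewrite (_ : [set u | _] =
    \big[setU/set0]_(i < #|V|) [set u | pattern s l u = enum_val i]).
    rewrite measure_bigsetU_ord//; last first.
    - apply/trivIsetP => i j _ _ ij; apply/seteqP; split=> // u.
      by case=> /= -> /enum_val_inj/eqP; rewrite (negPf ij).
    - by move=> i; exact: measurable_pattern_eq.
    rewrite (eq_bigr (fun=> p%:E)); last by move=> i _; exact: pE.
    by rewrite sumEFin sumr_const card_ord mulr_natl.
  rewrite -bigcup_seq; apply/seteqP; split=> u /=.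
    move=> uV; exists (enum_rank_in uV (pattern s l u)); first exact: mem_index_enum.
    by rewrite /= enum_rankK_in.
  by case=> i _ /= ->; exact: enum_valP.
rewrite E; congr EFin; congr (_ * _).
have := E [set: {set 'I_l}]%SET.
rewrite cardsT -cardsT -powersetT card_powerset cardsT card_ord.
rewrite (_ : [set u | _] = setT); last by apply/seteqP; split=> u //= _; rewrite inE.
rewrite probability_setT natrX => -[/esym/(canRL (mulKf _)) ->].
  by rewrite mulr1.
by rewrite expf_neq0.
Qed.

End Pattern.

(** * Conjugating the translations by majority twists *)

Definition zero_bits : bits := fun=> false.

Lemma addbitsA v v' u : addbits (addbits v v') u = addbits v (addbits v' u).
Proof. by apply/funext => i; rewrite /addbits addbA. Qed.

Lemma addbitsCA v v' u : addbits v (addbits v' u) = addbits v' (addbits v u).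
Proof. by apply/funext => i; rewrite /addbits addbCA. Qed.

Lemma addbitsK v u : addbits v (addbits v u) = u.
Proof. by apply/funext => i; rewrite /addbits addbA addbb. Qed.

Lemma add0bits u : addbits zero_bits u = u.
Proof. by []. Qed.

Lemma eq_pattern_addbits (s l : nat) (v u u' : bits) :
  pattern s l u = pattern s l u' ->
  pattern s l (addbits v u) = pattern s l (addbits v u').
Proof.
by move=> /setP uu'; apply/setP => i; move: (uu' i); rewrite !inE /addbits => ->.
Qed.

Section Skew.
Variables (n s : nat -> nat) (w : nat -> bits).
Hypothesis w_lt : forall k m, (s k <= m)%N -> w k m = false.
Hypothesis s_next : forall k, (s k + (n k).*2 <= s k.+1)%N.
Implicit Types (u v : bits).

Local Notation block k := (in_block (s k) (n k).*2).
Local Notation pat k := (pattern (s k) (n k).*2).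

Definition majority k u := (n k < #|pat k u|)%N.
Definition twist k u : bits :=
  addbits (if majority k u then w k else zero_bits) u.
Fixpoint conj_fwd K u : bits := if K is k.+1 then conj_fwd k (twist k u) else u.
Fixpoint conj_bwd K u : bits := if K is k.+1 then twist k (conj_bwd k u) else u.
(** Truncation of the conjugation by all twists; by [skew_stable] the value settles once [v]
    vanishes from [s K] on. *)
Definition skew K v u : bits := conj_fwd K (addbits v (conj_bwd K u)).

Lemma block_start_mono k j : (k <= j)%N -> (s k <= s j)%N.
Proof.
move=> /subnK <-; elim: (j - k)%N => // d IH.
by rewrite addSn (leq_trans IH)// (leq_trans _ (s_next _))// leq_addr.
Qed.

Lemma pattern_twist k j u : (k <= j)%N -> pat j (twist k u) = pat j u.
Proof.
move=> kj; apply: pattern_addbits_id => m /andP[sm _]; case: ifP => // _.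
by rewrite w_lt// (leq_trans (block_start_mono kj)).
Qed.

Lemma majority_twist k u : majority k (twist k u) = majority k u.
Proof. by rewrite /majority pattern_twist. Qed.

Lemma twistK k : involutive (twist k).
Proof. by move=> u; rewrite {1}/twist majority_twist /twist addbitsK. Qed.

Lemma twist_addbits k v u : (forall m, block k m -> v m = false) ->
  twist k (addbits v u) = addbits v (twist k u).
Proof. by move=> v0; rewrite /twist /majority pattern_addbits_id// addbitsCA. Qed.

Lemma pattern_conj_fwd K j u : (K <= j)%N -> pat j (conj_fwd K u) = pat j u.
Proof. by elim: K u => //= K IH u Kj; rewrite IH ?pattern_twist// ltnW. Qed.

Lemma pattern_conj_bwd K j u : (K <= j)%N -> pat j (conj_bwd K u) = pat j u.
Proof. by elim: K u => //= K IH u Kj; rewrite pattern_twist ?IH// ltnW. Qed.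

Lemma conj_fwdK K : cancel (conj_fwd K) (conj_bwd K).
Proof. by elim: K => //= K IH u; rewrite IH twistK. Qed.

Lemma conj_bwdK K : cancel (conj_bwd K) (conj_fwd K).
Proof. by elim: K => //= K IH u; rewrite twistK IH. Qed.

Lemma conj_fwd_addbits K v u : (forall k m, (k < K)%N -> block k m -> v m = false) ->
  conj_fwd K (addbits v u) = addbits v (conj_fwd K u).
Proof.
elim: K u => //= K IH u v0; rewrite twist_addbits ?IH// => [k m kK|m].
  by apply: v0; exact: ltnW.
exact: v0.
Qed.

Lemma pattern_skew k v u : pat k (skew k.+1 v u) = pat k (addbits v u).
Proof.
rewrite /skew /= pattern_conj_fwd// pattern_twist//; apply: eq_pattern_addbits.
by rewrite pattern_twist// pattern_conj_bwd.
Qed.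

Lemma skew0 K u : skew K zero_bits u = u.
Proof. by rewrite /skew add0bits conj_bwdK. Qed.

Lemma skewD K v v' u : skew K (addbits v v') u = skew K v (skew K v' u).
Proof. by rewrite /skew conj_fwdK addbitsA. Qed.

(** A translation avoiding block [K] commutes with [twist K], whose two occurrences then cancel. *)
Lemma skewS K v u : (forall m, block K m -> v m = false) ->
  skew K.+1 v u = skew K v u.
Proof. by move=> v0; rewrite /skew /= twist_addbits// twistK. Qed.

Lemma skew_stable K K' v u : (forall m, (s K <= m)%N -> v m = false) ->
  (K <= K')%N -> skew K' v u = skew K v u.
Proof.
move=> v0 /subnK <-; elim: (K' - K)%N => // d IH.
rewrite addSn skewS// => m /andP[sm _]; apply: v0.
by rewrite (leq_trans _ sm)// block_start_mono// leq_addl.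
Qed.

(* Exactly one of the two twists by w k = a + h is performed, which replaces the
   part a of the translation by h; the lower twists commute with t + h. *)
Lemma skew_flip k a t h u :
  (forall m, block k m -> a m = false) ->
  w k = addbits a h ->
  (forall j m, (j < k)%N -> block j m -> t m = false) ->
  (forall j m, (j < k)%N -> block j m -> h m = false) ->
  majority k (addbits t u) = ~~ majority k u ->
  skew k.+1 (addbits a t) u = addbits t (addbits h u).
Proof.
move=> a0 wE t0 h0 maj.
rewrite /skew /=; set x := conj_bwd k u.
have mx : majority k x = majority k u by rewrite /majority pattern_conj_bwd.
have mtx : majority k (addbits t x) = ~~ majority k u.
  by rewrite -maj /majority (eq_pattern_addbits _ (pattern_conj_bwd u (leqnn k))).
suff -> : twist k (addbits (addbits a t) (twist k x)) = addbits t (addbits h x).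
  by rewrite conj_fwd_addbits// conj_fwd_addbits// conj_bwdK.
have E1 : majority k (addbits (addbits a t) (twist k x)) = ~~ majority k u.
  rewrite -mtx addbitsA /majority pattern_addbits_id//.
  by rewrite (eq_pattern_addbits _ (pattern_twist x (leqnn k))).
rewrite {1}/twist E1 /twist mx wE; apply/funext => m; rewrite /addbits /zero_bits.
by case: (majority k u) => /=; case: (a m); case: (t m); case: (h m); case: (x m).
Qed.

Variable R : realType.
Local Notation mu := (@coin_measure R).

Definition measure_preserving (F : bits -> bits) :=
  measurable_fun setT F /\
  forall A : set bits, measurable A -> mu (F @^-1` A) = mu A.

Lemma measure_preserving_comp F F' : measure_preserving F -> measure_preserving F' ->
  measure_preserving (F \o F').
Proof.
move=> [mF pF] [mF' pF']; split; first exact: measurableT_comp.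
move=> A mA; rewrite comp_preimage pF' ?pF//.
by have := mF measurableT _ mA; rewrite setTI.
Qed.

Lemma measurable_majority k : measurable [set u | majority k u].
Proof. exact: (measurable_pattern _ (fun p => n k < #|p|)%N). Qed.

Lemma measure_preserving_addbits v N : (forall m, (N <= m)%N -> v m = false) ->
  measure_preserving (addbits v).
Proof.
move=> vN; split=> [|A mA]; first exact: measurable_addbits.
exact: coin_measure_addbits vN mA.
Qed.

(** The majority event is invariant under adding [w k]; the twist is that translation on the event
    and the identity off it. *)
Lemma measure_preserving_twist k : measure_preserving (twist k).
Proof.
pose M := [set u | majority k u].
have mM : measurable M by exact: measurable_majority.
have [mx px] := measure_preserving_addbits (@w_lt k).
have E A : twist k @^-1` A = (addbits (w k) @^-1` (M `&` A)) `|` (~` M `&` A).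
  have Mx u : M (addbits (w k) u) = M u.
    rewrite /M /= /majority pattern_addbits_id// => m /andP[sm _]; exact: w_lt.
  apply/seteqP; split=> u /=; rewrite /twist.
    by case: ifP => Mu; [left; rewrite Mx|right; rewrite /M /= Mu].
  by case=> -[]; rewrite ?Mx /M /=; [move=> ->|move=> /negP/negbTE ->].
have mxA A : measurable A -> measurable (addbits (w k) @^-1` A : set bits).
  by move=> mA; have := mx measurableT _ mA; rewrite setTI.
split=> [_ A mA|A mA]; rewrite ?setTI E.
  apply: measurableU; first by apply: mxA; exact: measurableI.
  by apply: measurableI => //; exact: measurableC.
rewrite measureU.
- transitivity (mu (M `&` A) + mu (~` M `&` A))%E.
    by congr (_ + _)%E; apply: px; exact: measurableI.
  rewrite -measureU.
  + by rewrite -setIUl setUv setTI.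
  + exact: measurableI.
  + by apply: measurableI => //; exact: measurableC.
  + by rewrite setIACA setICr set0I.
- by apply: mxA; exact: measurableI.
- by apply: measurableI => //; exact: measurableC.
- apply/seteqP; split=> // u [[+ _] [+ _]].
  by rewrite /M /= /majority pattern_addbits_id// => m /andP[sm _]; exact: w_lt.
Qed.

Lemma measure_preserving_skew K v N : (forall m, (N <= m)%N -> v m = false) ->
  measure_preserving (skew K v).
Proof.
have id_mp : measure_preserving id by split=> [|A mA]; [exact: measurable_id|].
move=> vN; apply: measure_preserving_comp; last apply: measure_preserving_comp.
- elim: K => //= K IH; exact: (measure_preserving_comp IH (measure_preserving_twist K)).
- exact: measure_preserving_addbits vN.
- elim: K => //= K IH; exact: (measure_preserving_comp (measure_preserving_twist K) IH).
Qed.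

End Skew.

(** * Chromatic and topological recurrence *)

(* [compact_cover] is stated for pointed spaces only. *)
Lemma compact_cover_inhabited (X : topologicalType) (x : X) (A : set X) :
  compact A -> cover_compact A.
Proof.
pose pX : ptopologicalType := HB.pack X (isPointed.Build X x).
by move=> cA; have : @compact pX A by []; rewrite compact_cover.
Qed.

Lemma topological_recurrence_of_colouring (R : realType) (G : countZmodType) (S : set G) :
  (forall c (chi : G -> 'I_c), exists2 s, S s & exists g, chi (s + g) = chi g) ->
  topological_recurrence R S.
Proof.
move=> chrom X T [[x0 _] cX [[T0 TD] Tc] Tmin] U oU U0.
move: (compact_cover_inhabited x0 cX) => /(_ G setT (fun g => T g @^-1` U)) [].
- by move=> g _; apply: open_comp => // x _; exact: Tc.
- move=> x _; have [y [Uy [g _ gx]]] := Tmin x U U0 oU.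
  by exists g => //=; rewrite gx.
move=> D _ cov; pose P g h := `[< U (T (h + g) x0) >].
have hasP g : has (P g) (enum_fset D).
  have [h hD Uh] := cov (T g x0) I; apply/hasP; exists h => //.
  by apply/asboolP; rewrite TD.
have lt g : (find (P g) (enum_fset D) < size (enum_fset D))%N by rewrite -has_find.
have [s Ss [g /(congr1 val) /= E]] := chrom _ (fun g => Ordinal (lt g)).
have /asboolP U1 := nth_find 0 (hasP g).
have /asboolP U2 := nth_find 0 (hasP (s + g)).
rewrite E in U2; exists s => //; set h := nth _ _ _ in U1 U2.
exists (T s (T (h + g) x0)); split; last by exists (T (h + g) x0).
by rewrite -TD addrCA.
Qed.

(** * Kriz's set and its measure preserving system *)

Definition G2bits (g : G2) : bits := fun n => monalg.mcoeff n g != 0.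

Lemma Z2_addr_neq0 (a b : 'Z_2) : (a + b != 0) = (a != 0) (+) (b != 0).
Proof. by move: a b => [[|[|a]] //= ia] [[|[|b]] //= ib]. Qed.

Lemma Z2_addrr (a : 'Z_2) : a + a = 0.
Proof. by apply/val_inj; case: a => [[|[|a]] //= ia]. Qed.

Lemma G2_addrr (g : G2) : g + g = 0.
Proof. by apply/monalg.malgP => n; rewrite monalg.mcoeffD monalg.mcoeff0 Z2_addrr. Qed.

Lemma G2bits0 : G2bits 0 = zero_bits.
Proof. by apply/funext => n; rewrite /G2bits monalg.mcoeff0 eqxx. Qed.

Lemma G2bitsD g h : G2bits (g + h) = addbits (G2bits g) (G2bits h).
Proof. by apply/funext => n; rewrite /G2bits monalg.mcoeffD Z2_addr_neq0. Qed.

Lemma G2bitsU n : G2bits (monalg.mkmalgU n 1) = unit_bits n.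
Proof.
apply/funext => m; rewrite /G2bits monalg.mcoeffU /unit_bits [m == n]eq_sym.
by case: (n == m).
Qed.

Lemma G2bits_bounded g : exists N, forall m, (N <= m)%N -> G2bits g m = false.
Proof.
exists (\max_(i <- enum_fset (monalg.msupp g)) i.+1) => m; apply: contraTF.
rewrite /G2bits monalg.mcoeff_neq0 -ltnNge => mg.
exact: (@leq_bigmax_seq _ _ xpredT (fun i => i.+1) m mg).
Qed.

Definition G2_bound g : nat := sval (cid (G2bits_bounded g)).

Lemma G2_boundP g m : (G2_bound g <= m)%N -> G2bits g m = false.
Proof. exact: (svalP (cid (G2bits_bounded g))). Qed.

Lemma G2bits_surj v N : (forall m, (N <= m)%N -> v m = false) -> exists g, G2bits g = v.
Proof.
elim: N v => [|N IH] v v0.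
  by exists 0; rewrite G2bits0; apply/funext => m; rewrite v0.
case vN : (v N); last first.
  by apply: IH => m; rewrite leq_eqVlt => /predU1P[<-//|/v0].
have [|g gE] := IH (addbits (unit_bits N) v).
  move=> m; rewrite /addbits /unit_bits leq_eqVlt => /predU1P[<-|nN].
    by rewrite eqxx vN.
  by rewrite v0// gtn_eqF.
by exists (monalg.mkmalgU N 1 + g); rewrite G2bitsD G2bitsU gE addbitsK.
Qed.

(** The factor [2 ^ (k + 3)] makes the densities of the balanced windows sum to at most 1/4. *)
Definition half_size k : nat :=
  s2val (cid2 (central_window_small k (2 ^ (k + 3)))).
(* The 2-adic valuation takes every value infinitely often. *)
Definition shift k : G2 := odflt 0 (choice.unpickle (logn 2 k)).
(* Coordinate 0 belongs to no block. *)
Fixpoint start k : nat :=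
  maxn (G2_bound (shift k)) (if k is k'.+1 then start k' + (half_size k').*2 else 1)%N.
Definition radius k := (half_size k - k)%N.
Local Notation pat k := (pattern (start k) (half_size k).*2).
Local Notation block k := (in_block (start k) (half_size k).*2).

Lemma half_size_gt k : (k < half_size k)%N.
Proof. exact: (s2valP (cid2 (central_window_small k (2 ^ (k + 3))))). Qed.

Lemma start_next k : (start k + (half_size k).*2 <= start k.+1)%N.
Proof. exact: leq_maxr. Qed.

Lemma start_gt k : (k < start k)%N.
Proof.
elim: k => [|k IH]; first exact: leq_maxr.
by have := start_next k; have := half_size_gt k; lia.
Qed.

Lemma start_mono k j : (k <= j)%N -> (start k <= start j)%N.
Proof. exact: (block_start_mono start_next). Qed.

Definition twister k : bits := addbits (G2bits (shift k)) (unit_bits 0).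

Lemma G2bits_shift k m : (start k <= m)%N -> G2bits (shift k) m = false.
Proof.
by move=> km; apply: G2_boundP; apply: leq_trans km; case: k => *; exact: leq_maxl.
Qed.

Lemma unit_bits0_start k m : (start k <= m)%N -> unit_bits 0 m = false.
Proof.
by move=> km; rewrite /unit_bits gtn_eqF// (leq_trans _ km)// (leq_trans _ (start_gt k)).
Qed.

Lemma twister_lt k m : (start k <= m)%N -> twister k m = false.
Proof. by move=> km; rewrite /twister /addbits G2bits_shift// (unit_bits0_start km). Qed.

Lemma shift_surj g c : exists2 k, (c <= k)%N & shift k = g.
Proof.
(* The odd factor gives size at least [c] without affecting the 2-adic valuation. *)
exists (2 ^ choice.pickle g * (2 * c).+1)%N.
  by rewrite (leq_trans _ (leq_pmull _ _))// ?expn_gt0//; lia.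
rewrite /shift lognM ?expn_gt0// pfactorK// (@lognE 2) /= dvdn2 /= oddM /= addn0.
by rewrite choice.pickleK.
Qed.

Definition kriz_set : set G2 := [set g | exists k t,
  [/\ g = shift k + t,
      forall m, G2bits t m -> block k m &
      #|pat k (G2bits t)| = (radius k).*2]].

(** With [shift k = - g] the translate contains the unshifted [k]-th piece. Kneser's theorem,
    available since [c <= k], gives disjoint subsets of the block with equal colours; their sum is
    [s], as the group has exponent 2. *)
Lemma kriz_set_colouring g c (chi : G2 -> 'I_c) :
  exists2 s, [set s + g | s in kriz_set] s & exists y, chi (s + y) = chi y.
Proof.
have [k ck kE] := shift_surj (- g) c.
have emb (B : {set 'I_(half_size k).*2}) : {x : G2 | G2bits x = fun m =>
    (start k <= m)%N && (if insub (m - start k)%N is Some i then i \in B else false)}.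
  apply: cid; apply: (@G2bits_surj _ (start k + (half_size k).*2)) => m km.
  by case: insubP => [i + _|]; rewrite ?andbF//; lia.
have embE B (i : 'I_(half_size k).*2) : G2bits (sval (emb B)) (start k + i)%N = (i \in B).
  rewrite (svalP (emb B)) leq_addr addKn; case: insubP => [j _ /val_inj -> //|].
  by rewrite ltn_ord.
have emb_block B m : G2bits (sval (emb B)) m -> block k m.
  rewrite (svalP (emb B)) => /andP[km]; case: insubP => // i + _ _.
  by rewrite /in_block; lia.
have hk := half_size_gt k.
have [||B [B' [cB cB' dBB' chiE]]] :=
  @kneser _ c (radius k) (fun B => chi (sval (emb B))).
- by rewrite /radius; lia.
- by rewrite card_ord /radius; lia.
set x := sval (emb B) in chiE *; set x' := sval (emb B') in chiE *.
exists (x + x'); last by exists x'; rewrite -addrA G2_addrr addr0.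
exists (shift k + (x + x')); last by rewrite kE addrC addrA subrr add0r.
exists k, (x + x'); split=> //.
  move=> m; rewrite G2bitsD /addbits; have := @emb_block B m; have := @emb_block B' m.
  rewrite -/x -/x'; case: (G2bits x m) => [_ h _|]; first exact: h.
  by case: (G2bits x' m) => // h _ _; exact: h.
rewrite (_ : pattern _ _ _ = (B :|: B')%SET).
  by rewrite cardsU (disjoint_setI0 dBB') cards0 subn0 cB cB' addnn.
apply/setP => i; rewrite !inE G2bitsD /addbits !embE.
by have := disjointFr dBB' (x := i); case: (i \in B) => //= ->.
Qed.

(** Each coordinate lies in none or exactly two of the three patterns. *)
Lemma pattern_card_le (s l : nat) (t u : bits) :
  (#|pattern s l t| <= #|pattern s l u| + #|pattern s l (addbits t u)| /\
   #|pattern s l t| + #|pattern s l u| + #|pattern s l (addbits t u)| <= l + l)%N.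
Proof.
set p := pattern s l t; set q := pattern s l u; set r := pattern s l _.
split.
  apply: (@leq_trans #|q :|: r|%SET); last by rewrite cardsU leq_subr.
  apply/subset_leq_card/fintype.subsetP => i; rewrite !inE /addbits => ->.
  by case: (u _).
have pqr : (p \subset ~: q :|: ~: r)%SET.
  by apply/fintype.subsetP => i; rewrite !inE /addbits => ->; case: (u _).
have := subset_leq_card pqr; rewrite cardsU => le.
have := cardsC q; have := cardsC r; rewrite !card_ord; lia.
Qed.

(** * The twisted action and a set of positive measure without returns *)

Section Measure.
Variable R : realType.
Local Notation mu := (@coin_measure R).

(** Truncating at [G2_bound g] suffices: [start k] exceeds [k], so later blocks miss the support of
    [g]. *)
Definition kriz_action (g : G2) : bits -> bits :=
  skew half_size start twister (G2_bound g) (G2bits g).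

Lemma kriz_actionE g K : (forall m, (start K <= m)%N -> G2bits g m = false) ->
  kriz_action g =1 skew half_size start twister K (G2bits g).
Proof.
move=> g0 u; rewrite /kriz_action.
have gb m : (start (G2_bound g) <= m)%N -> G2bits g m = false.
  by move=> sm; apply: G2_boundP; rewrite (leq_trans _ sm)// ltnW// start_gt.
rewrite -(skew_stable twister_lt start_next u gb (leq_maxl _ K)).
by rewrite -(skew_stable twister_lt start_next u g0 (leq_maxr (G2_bound g) _)).
Qed.

Lemma kriz_action_is_action : is_action kriz_action.
Proof.
split=> [u|g h u].
  by rewrite /kriz_action G2bits0 (skew0 twister_lt start_next).
pose K := maxn (G2_bound (g + h)) (maxn (G2_bound g) (G2_bound h)).
have bnd x : (G2_bound x <= K)%N -> forall m, (start K <= m)%N -> G2bits x m = false.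
  move=> xK m sm; apply: G2_boundP.
  by rewrite (leq_trans xK)// (leq_trans _ sm)// ltnW// start_gt.
rewrite !(@kriz_actionE _ K); try by apply: bnd; rewrite /K; lia.
by rewrite G2bitsD (skewD twister_lt start_next).
Qed.

Lemma kriz_action_preserving : measure_preserving_action mu kriz_action.
Proof.
have act := kriz_action_is_action; have [a0 aD] := act.
have mp g : measure_preserving R (kriz_action g).
  by apply: measure_preserving_skew; [exact: twister_lt|exact: G2_boundP].
split=> // [g|g D mD]; first by have [] := mp g.
have [_ p] := mp (- g); rewrite -[RHS](p D mD); congr (mu _); apply/seteqP; split=> u /=.
  by case=> v Dv <-; rewrite -aD addNr a0.
by move=> Du; exists (kriz_action (- g) u) => //; rewrite -aD subrr a0.
Qed.

Definition balanced k (u : bits) :=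
  (half_size k - k <= #|pat k u| <= half_size k + k)%N.

Lemma measurable_balanced k : measurable [set u | balanced k u].
Proof.
exact: (measurable_pattern _ (fun p : {set 'I__} =>
  half_size k - k <= #|p| <= half_size k + k)%N).
Qed.

Definition kriz_domain : set bits :=
  [set u | ~~ u 0%N /\ forall k, ~~ balanced k u].

Lemma kriz_domain_disjoint g u : kriz_set g -> kriz_domain u ->
  kriz_domain (kriz_action g u) -> False.
Proof.
case=> k [t [-> tb ct]] [u0 ub] [v0 vb].
have t_out j m : (j < k)%N -> block j m -> G2bits t m = false.
  move=> jk /andP[_ mj]; apply: contraTF mj => /tb /andP[km _].
  by rewrite -leqNgt (leq_trans (start_next j))// (leq_trans _ km)// start_mono.
have h0 j m : block j m -> unit_bits 0 m = false by move=> /andP[]; move/unit_bits0_start.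
have a0 m : block k m -> G2bits (shift k) m = false by move=> /andP[]; move/G2bits_shift.
have actE : kriz_action (shift k + t) u =
    skew half_size start twister k.+1 (addbits (G2bits (shift k)) (G2bits t)) u.
  rewrite -G2bitsD; apply: kriz_actionE => m km; rewrite G2bitsD /addbits.
  rewrite G2bits_shift ?(leq_trans _ km)// ?start_mono//.
  apply/negbTE/negP => /tb /andP[_ mk].
  by move: mk; rewrite ltnNge (leq_trans (start_next k) km).
rewrite actE in vb v0.
set a := G2bits (shift k) in a0 actE vb v0 *.
have pE : pat k (skew half_size start twister k.+1 (addbits a (G2bits t)) u) =
    pat k (addbits (G2bits t) u).
  by rewrite (pattern_skew twister_lt start_next) addbitsA pattern_addbits_id.
move: (ub k) (vb k); rewrite /balanced pE.
have := pattern_card_le (start k) (half_size k).*2 (G2bits t) u.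
rewrite ct /radius => tle; have hk := half_size_gt k => ubk vbk.
(* Two weights below [half_size k - k] would violate the first inequality of [tle], two above
   [half_size k + k] the second. *)
have flip : majority half_size start k (addbits (G2bits t) u) =
    ~~ majority half_size start k u.
  by rewrite /majority; lia.
move: v0; rewrite (skew_flip (h := unit_bits 0) twister_lt start_next a0)//.
  have t0 : G2bits t 0%N = false.
    by apply/negbTE/negP => /tb /andP[]; have := start_gt k; lia.
  by rewrite /addbits t0 /unit_bits eqxx /= u0.
by move=> j m _; exact: h0.
Qed.

Lemma measurable_kriz_domain : measurable kriz_domain.
Proof.
rewrite [X in measurable X](_ : _ =
  ~` [set u : bits | u 0%N] `&` \bigcap_k ~` [set u | balanced k u]).
  apply: measurableI; first by apply: measurableC; exact: measurable_coin.
  apply: bigcapT_measurable => k; apply: measurableC.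
  exact: measurable_balanced.
apply/seteqP; split=> u /= [/negP u0 ub]; split=> //.
  by move=> k _; apply/negP; exact: ub.
by move=> k; apply/negP; exact: ub.
Qed.

Lemma coin_measure_coin0 : mu [set u | u 0%N] = (2^-1)%:E.
Proof.
have := @coin_measure_pattern 0 1 R [set [set: 'I_1]]%SET.
rewrite cards1 expr1 mul1r => <-.
congr (mu _); apply/seteqP; split=> u /=; rewrite inE.
  by move=> u0; apply/eqP/setP => i; rewrite !inE ord1.
by move/eqP/setP => /(_ ord0); rewrite !inE.
Qed.

(** The bound is shaped for [epsilon_trick0], which sums it to [4^-1]. *)
Lemma coin_measure_balanced k :
  (mu [set u | balanced k u] <= (4^-1 / (2 ^ k.+1)%:R)%:E)%E.
Proof.
have := s2valP' (cid2 (central_window_small k (2 ^ (k + 3))%N)).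
rewrite -/(half_size k); set W := finset _ => le.
have -> : [set u | balanced k u] = [set u | pat k u \in W].
  by apply/seteqP; split=> u /=; rewrite inE.
rewrite coin_measure_pattern lee_fin ler_pdivrMr ?exprn_gt0//.
rewrite -invfM -natrM mulrC ler_pdivlMr ?ltr0n ?muln_gt0 ?expn_gt0//.
rewrite -natrX -natrM ler_nat (_ : 4 * 2 ^ k.+1 = 2 ^ (k + 3))%N//.
by rewrite -(expnD 2 2); congr (2 ^ _)%N; lia.
Qed.

(** The complement has measure at most 1/2, from coordinate 0, plus 1/4, from the balanced
    blocks. *)
Lemma kriz_domain_gt0 : (0 < mu kriz_domain)%E.
Proof.
have mD := measurable_kriz_domain.
have mb := measurable_balanced.
have mU : measurable (\bigcup_k [set u | balanced k u]) by exact: bigcupT_measurable.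
have bU : (mu (\bigcup_k [set u | balanced k u]) <= (4^-1)%:E)%E.
  apply: le_trans (epsilon_trick0 xpredT _); last by rewrite invr_ge0.
  apply: le_trans (lee_nneseries _ (fun k _ => coin_measure_balanced k)); last by [].
  exact: measure_sigma_subadditive.
have : (mu (~` kriz_domain) <= (2^-1 + 4^-1)%:E)%E.
  rewrite EFinD -coin_measure_coin0; apply: le_trans (leeD2l _ bU).
  apply: le_trans (measureU2 _ _ _) => //; last exact: measurable_coin.
  apply: le_measure; rewrite ?inE.
  - exact: measurableC.
  - by apply: measurableU => //; exact: measurable_coin.
  move=> u /= /not_andP[/negP|/existsNP[k /negP]]; rewrite negbK; first by left.
  by right; exists k.
rewrite (_ : mu _ = (1 - mu kriz_domain)%E); last exact: probability_setC.
apply: contraTT; rewrite -leNgt -ltNge => le0.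
have -> : mu kriz_domain = 0%E by apply/eqP; rewrite eq_le le0 measure_ge0.
by rewrite sube0 lte_fin; lra.
Qed.

Lemma kriz_set_not_measurable_recurrence : ~ measurable_recurrence R kriz_set.
Proof.
move=> /(_ _ _ mu kriz_action kriz_action_preserving kriz_domain).
move=> /(_ measurable_kriz_domain kriz_domain_gt0) [g Sg].
rewrite (_ : _ `&` _ = set0) ?measure0 ?ltxx//.
apply/seteqP; split=> // v [Dv [u Du uv]]; rewrite -uv in Dv.
exact: (kriz_domain_disjoint Sg Du Dv).
Qed.

End Measure.

Theorem theorem1p1 (R : realType) :
  exists S : set G2,
    (forall g : G2, topological_recurrence R [set s + g | s in S]) /\
    ~ measurable_recurrence R S.
Proof.
exists kriz_set; split=> [g|]; last exact: kriz_set_not_measurable_recurrence.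
by apply: topological_recurrence_of_colouring => c chi; exact: kriz_set_colouring.
Qed.
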